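(* There exists a function $\varepsilon:\mathbb{Z}_{\ge 1}\to\mathbb{R}$ with $\lim_{k\to\infty}\varepsilon(k)=0$ such that for every integer $k\ge 1$ and every $n$, every outer $k$-planar graph on $n$ vertices has at most $(\sqrt{2}+\varepsilon(k))\sqrt{k}\,n$ diagonals.
   Context: A convex geometric graph is a drawing of a finite simple graph in the plane whose vertex set is a set $V$ of points in convex position (no three collinear) and whose edges are drawn as straight-line segments between their endpoints. Two edges cross if they share a point in their relative interiors. The drawing is $k$-plane if each edge crosses at most $k$ other edges. An outer $k$-planar graph is a graph given with such a convex geometric $k$-plane drawing. An edge of the graph is a diagonal if it is not an edge of the boundary of the convex hull of the point set $V$. *)

(* Defs.v *)
(* MathComp / MathComp-Analysis *)
From HB Require Import structures.
From mathcomp Require Import all_boot all_order all_algebra.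
From mathcomp Require Import all_classical all_reals all_analysis.
Set Implicit Arguments.
Unset Strict Implicit.
Unset Printing Implicit Defensive.
Import Order.TTheory GRing.Theory Num.Theory.
Import numFieldNormedType.Exports.
Local Open Scope classical_set_scope.
Local Open Scope ring_scope.

Notation plane R := 'rV[R]_2.

Definition segment (R : realType) (a b : plane R) : set (plane R) :=
  [set (1 - t) *: a + t *: b | t in `[0, 1]].

(* The relative interior of [segment a b] when [a != b]. *)
Definition open_segment (R : realType) (a b : plane R) : set (plane R) :=
  [set (1 - t) *: a + t *: b | t in `]0, 1[].

Definition convex_hull (R : realType) (A : set (plane R)) : set (plane R) :=
  smallest (@convex_set R (plane R)) A.

Definition frontier (T : topologicalType) (A : set T) : set T :=
  closure A `\` interior A.

(* Strict convex position: every point is a vertex of the convex hull. This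
   forces [pos] to be injective and no three of the points to be collinear. *)
Definition convex_position (R : realType) (V : finType) (pos : V -> plane R) :=
  forall v : V, ~ convex_hull (pos @` [set w | w != v]) (pos v).

(* The graph is simple: its edges are 2-element subsets of the finite set of
   vertices; the drawing is determined by the placement of the vertices. *)
Record convex_geometric_graph (R : realType) (V : finType) :=
  ConvexGeometricGraph {
    edges : {set {set V}};
    card_edge : forall A : {set V}, A \in edges -> #|A| = 2%N;
    pos : V -> plane R;
    pos_convex : convex_position pos
  }.

Section Drawing.
Variables (R : realType) (V : finType) (G : convex_geometric_graph R V).

Definition edge_segment (A : {set V}) : set (plane R) :=
  [set p | exists u v, A = [set u; v]%SET /\ segment (pos G u) (pos G v) p].

Definition edge_interior (A : {set V}) : set (plane R) :=
  [set p | exists u v, A = [set u; v]%SET /\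
                       open_segment (pos G u) (pos G v) p].

Definition crosses (A B : {set V}) : Prop :=
  A != B /\ edge_interior A `&` edge_interior B !=set0.

Definition k_plane (k : nat) : Prop :=
  forall A, A \in edges G ->
    (#|[set B in edges G | `[< crosses A B >]]%SET| <= k)%N.

(* The points being in convex position, a segment between two of them is a
   side of the convex hull iff it runs along the boundary of the hull. *)
Definition hull_edge (A : {set V}) : Prop :=
  edge_segment A `<=` frontier (convex_hull (range (pos G))).

Definition diagonals : {set {set V}} :=
  [set A in edges G | ~~ `[< hull_edge A >]]%SET.

End Drawing.

Record outer_k_planar_graph (R : realType) (k : nat) (V : finType) :=
  OuterKPlanarGraph {
    drawing :> convex_geometric_graph R V;
    drawing_k_plane : k_plane drawing k
  }.

(* Main.v *)
Require Import Defs.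
From HB Require Import structures.
From mathcomp Require Import all_boot all_order all_algebra.
From mathcomp Require Import all_classical all_reals all_analysis.
From mathcomp Require Import zify ring lra.
Set Implicit Arguments.
Unset Strict Implicit.
Unset Printing Implicit Defensive.

(** Number the vertices along the hull.  Two edges whose end points interleave
cross, so the problem becomes one about pairs on a line: if every pair is
interleaved with at most [k] others, how many pairs can there be?  Let [L] be
about [sqrt (2 k)] and measure an edge by the number of steps between its ends.

If no edge is longer than [L], each vertex is the right end of at most [L]
edges, so there are at most [L * n] of them.  Otherwise take a shortest edge
[e] among those longer than [L], say of length [d], and delete the [d - 1]
vertices strictly under it.  The edges lost are of two kinds.
- Those interleaved with [e]: at most [k].
- Those under [e], all of length at most [L] by the choice of [e].  As the
  first few vertices of an interval have fewer than [L] predecessors in it,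
  these number at most [L * d - L * (L - 1) / 2], not merely [L * d].
The gain [L ^ 2 / 2] from the boundary of the interval pays for the [k] crossing
edges exactly when [L ^ 2 >= 2 k]; this is where the constant [sqrt 2] comes
from.  So each deletion costs about [L] edges per deleted vertex, and induction
gives at most [(L + 3 / 2) * n] edges in total
([card_interleave_edges_le]).  With [L <= sqrt (2 k) + 1] this is
[(sqrt 2 + eps k) * sqrt k * n] for [eps k = 5 / (2 * sqrt k)].

The numbering is by angle around the lexicographically smallest vertex
([exists_convex_rank]): seen from there all other vertices lie in a half-plane,
where orientation is transitive, and convex position makes every triple taken
in increasing order turn left.  Four points all of whose triples turn left have
crossing diagonals ([diagonals_meet]). *)

(** * Pairs on a line *)

Section LinearOrder.
Variables (V : finType) (r : V -> nat).
Hypothesis r_inj : injective r.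

(** The length of an edge is relative to the surviving vertices [S]: it shrinks
when vertices under the edge are deleted. *)
Definition span (S : {set V}) (a b : V) : nat :=
  #|[set x in S | r a < r x <= r b]|.

Definition edges_on (S : {set V}) (E : {set V * V}) : Prop :=
  forall p, p \in E -> [/\ p.1 \in S, p.2 \in S & r p.1 < r p.2].

Definition interleave (p q : V * V) : bool :=
  [&& r p.1 < r q.1, r q.1 < r p.2 & r p.2 < r q.2] ||
  [&& r q.1 < r p.1, r p.1 < r q.2 & r q.2 < r p.2].

(** The left ends other than the leftmost one, together with [m] itself, are
distinct vertices counted by the span of the longest edge. *)
Lemma card_short_edges_into (L : nat) (S : {set V}) (F : {set V * V}) (m : V) :
  m \in S -> (forall p, p \in F -> [/\ p.1 \in S, p.2 = m, r p.1 < r p.2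
                                     & span S p.1 p.2 <= L]) ->
  #|F| <= L.
Proof.
move=> mS FP.
have [->|[p0 p0F]] := set_0Vmem F; first by rewrite cards0.
pose p := [arg min_(p < p0 in F) r p.1].
have [pF pmin] : p \in F /\ forall q, q \in F -> r p.1 <= r q.1.
  by rewrite /p; case: arg_minnP.
have [pS pm pr] := FP p pF; apply: leq_trans.
have im_inj : {in F &, injective (fun q => q.1)}.
  move=> [q1 q2] [q1' q2'] /FP[/= _ -> _ _] /FP[/= _ -> _ _] -> //.
rewrite -(card_in_imset im_inj) (cardsD1 p.1) imset_f//.
have mN : m \notin [set q.1 | q in F] :\ p.1.
  apply/negP => /setD1P[_ /imsetP[q /FP[_ qm qr _] mq]].
  by rewrite qm mq ltnn in qr.
rewrite add1n -[X in X <= _]add1n.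
have := cardsU1 m ([set q.1 | q in F] :\ p.1); rewrite mN /= => <-.
apply/subset_leq_card/fintype.subsetP => x /setU1P[->|/setD1P[xp /imsetP[q qF xq]]].
  by rewrite inE mS pm leqnn -{1}pm pr.
have [qS qm qr _] := FP q qF.
rewrite inE xq qS pm -qm (ltnW qr) andbT /=.
rewrite ltn_neqAle pmin// andbT; apply: contraNneq xp => /r_inj pq.
by rewrite xq pq.
Qed.

Lemma span_setD1 (S : {set V}) (m a b : V) : span (S :\ m) a b <= span S a b.
Proof.
apply/subset_leq_card/fintype.subsetP => x; rewrite !inE => /andP[/andP[_ ->]].
by [].
Qed.

(** Adding vertices from left to right, the vertex with [t] predecessors is the
right end of at most [minn L t] edges.  Keeping the [t] for [t < L], instead of
bounding every term by [L], is what saves about [L ^ 2 / 2]. *)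
Lemma card_short_edges (L n : nat) (S : {set V}) (F : {set V * V}) :
  #|S| = n -> edges_on S F -> (forall p, p \in F -> span S p.1 p.2 <= L) ->
  #|F| <= \sum_(t < n) minn L t.
Proof.
elim: n S F => [|n IHn] S F cS FS Fshort.
  rewrite big_ord0 leqn0 cards_eq0; apply/eqP/setP => p; rewrite inE.
  by apply/negP => /FS[]; move/eqP: cS; rewrite cards_eq0 => /eqP ->; rewrite inE.
have [x0 x0S] : exists x0, x0 \in S by apply/card_gt0P; rewrite cS.
pose m := [arg max_(x > x0 in S) r x].
have [mS mmax] : m \in S /\ forall x, x \in S -> r x <= r m.
  by rewrite /m; case: arg_maxnP.
have cSm : #|S :\ m| = n by move: cS; rewrite (cardsD1 m) mS => -[].
pose F1 := [set p in F | p.2 == m].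
rewrite big_ord_recr /= addnC -(cardsID F1 F); apply: leq_add.
  have -> : F :&: F1 = F1 by apply/setP => p; rewrite !inE andbA andbb.
  rewrite leq_min; apply/andP; split.
    apply: (card_short_edges_into mS) => p; rewrite inE => /andP[pF /eqP pm].
    by have [] := FS p pF; have := Fshort p pF.
  have im_inj : {in F1 &, injective (fun q => q.1)}.
    by move=> [? ?] [? ?]; rewrite !inE /= => /andP[_ /eqP->] /andP[_ /eqP->] ->.
  rewrite -(card_in_imset im_inj) -cSm; apply/subset_leq_card/fintype.subsetP => x.
  move=> /imsetP[p]; rewrite inE => /andP[/FS[p1 _ pr] /eqP pm] ->.
  by rewrite !inE p1 andbT; apply: contraTneq pr => ->; rewrite pm ltnn.
apply: (IHn (S :\ m)) => // p /setDP[pF]; rewrite inE pF /= => pm; last first.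
  exact: leq_trans (span_setD1 _ _ _ _) (Fshort p pF).
have [p1 p2 pr] := FS p pF; split=> //; rewrite !inE ?p1 ?p2 ?pm ?andbT//.
by apply: contraTneq pr => ->; rewrite -leqNgt mmax.
Qed.

Lemma sum_minn (L n : nat) :
  L <= n -> 2 * (\sum_(t < n) minn L t) + L * L.+1 = 2 * L * n.
Proof.
elim: n => [|n IHn]; first by rewrite leqn0 => /eqP->; rewrite big_ord0.
rewrite leq_eqVlt => /predU1P[->|Ln].
  have -> : \sum_(t < n.+1) minn n.+1 t = \sum_(t < n.+1) t.
    by apply: eq_bigr => t _; apply/minn_idPr/ltnW.
  elim: (n.+1) => [|j IHj]; first by rewrite big_ord0.
  rewrite big_ord_recr /=; move: IHj; set s := bigop _ _ _ => IHj.
  by nia.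
rewrite big_ord_recr /= (minn_idPl _)//; move: (IHn Ln); set s := bigop _ _ _ => IHs.
by nia.
Qed.

Lemma sum_minn_le (L n : nat) : \sum_(t < n) minn L t <= L * n.
Proof.
rewrite mulnC -[n in n * L]card_ord -sum_nat_const.
by apply: leq_sum => t _; exact: geq_minl.
Qed.

(** Induction on [S], deleting the vertices under a shortest edge [e] of length
more than [L].  The edge [e] itself survives, so the rest is again an instance.
The slack [3] pays for [e] deleting one vertex fewer than its length; positivity
of [L] ensures that at least one vertex is deleted. *)
Lemma card_interleave_edges_le (k L : nat) (S : {set V}) (E : {set V * V}) :
  0 < L -> 2 * k <= L * L -> edges_on S E ->
  (forall p, p \in E -> #|[set q in E | interleave p q]| <= k) ->
  2 * #|E| <= (2 * L + 3) * #|S|.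
Proof.
move=> L0 kL; elim: {S}_.+1 {-2}S (ltnSn #|S|) E => // n IHn S Sn E ES Ek.
have [allshort|] := boolP [forall p in E, span S p.1 p.2 <= L].
  have /leq_trans := card_short_edges erefl ES (fun p => forall_inP allshort p).
  by move=> /(_ _ (sum_minn_le _ _)); nia.
rewrite negb_forall_in => /exists_inP[e0 e0E]; rewrite -ltnNge => e0L.
pose e := [arg min_(p < e0 in [set p in E | L < span S p.1 p.2]) span S p.1 p.2].
have [eE eL emin] : [/\ e \in E, L < span S e.1 e.2 &
    forall p, p \in E -> L < span S p.1 p.2 -> span S e.1 e.2 <= span S p.1 p.2].
  rewrite /e; case: arg_minnP; first by rewrite inE e0E.
  move=> p; rewrite inE => /andP[pE pL] pmin; split=> // q qE qL.
  by apply: pmin; rewrite inE qE.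
clearbody e; clear e0 e0E e0L.
have [e1S e2S er] := ES e eE.
pose C := [set x in S | r e.1 <= r x <= r e.2].
pose T := [set x in S | r e.1 < r x < r e.2].
have TS : T \subset S by apply/fintype.subsetP => x; rewrite inE => /andP[].
have cC : #|C| = (span S e.1 e.2).+1.
  rewrite (cardsD1 e.1) !inE e1S leqnn (ltnW er) add1n /span.
  congr (#|pred_of_set _|.+1).
  apply/setP => x; rewrite !inE; case: eqVneq => [->|xe].
    by rewrite ltnn andbF.
  by rewrite [r e.1 < _]ltn_neqAle (inj_eq r_inj) eq_sym xe.
have cT : #|T|.+1 = span S e.1 e.2.
  rewrite /span (cardsD1 e.2 [set x in S | _]) !inE e2S leqnn er add1n.
  congr (#|pred_of_set _|.+1); apply/setP => x; rewrite !inE.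
  case: eqVneq => [->|xe]; first by rewrite ltnn !andbF.
  by rewrite [r x < r e.2]ltn_neqAle (inj_eq r_inj) xe.
pose E' := [set p in E | (p.1 \notin T) && (p.2 \notin T)].
pose X := [set q in E | interleave e q].
pose I := [set q in E | [&& q.1 \in C, q.2 \in C & q != e]].
(* An edge losing an end point, i.e. with an end strictly under [e], either
   leaves the interval [C], and is then interleaved with [e], or lies in it. *)
have E_sub : E \subset E' :|: X :|: I.
  apply/fintype.subsetP => q qE; have [q1S q2S qr] := ES q qE.
  rewrite !inE qE q1S q2S /=.
  have [->|qe] := eqVneq q e; first by rewrite !ltnn !andbF.
  by rewrite /interleave; lia.
have E'_le : 2 * #|E'| <= (2 * L + 3) * #|S :\: T|.
  apply: IHn.
  - have := cardsID T S; rewrite (finset.setIidPr TS).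
    move: Sn cT eL; move: #|S| #|T| #|_| (span _ _ _) => s t u d.
    by lia.
  - move=> q; rewrite inE => /and3P[qE q1T q2T]; have [q1S q2S qr] := ES q qE.
    by split=> //; exact/setDP.
  - move=> q; rewrite inE => /andP[qE _]; apply: leq_trans (Ek q qE).
    by apply/subset_leq_card/fintype.subsetP => q'; rewrite !inE => /andP[/andP[-> _] ->].
have I_le : #|I| <= \sum_(t < (span S e.1 e.2).+1) minn L t.
  apply: (card_short_edges cC) => q; rewrite inE => /andP[qE /and3P[q1C q2C qe]].
    by have [_ _] := ES q qE.
  have [q1S q2S qr] := ES q qE.
  have sub : span C q.1 q.2 <= span S q.1 q.2.
    apply/subset_leq_card/fintype.subsetP => x; rewrite !inE.
    by move=> /andP[/andP[-> _] ->].
  apply: leq_trans sub _; rewrite leqNgt; apply/negP => qL.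
  (* An edge inside [C] other than [e] is strictly shorter than [e], so if it
     were longer than [L] it would contradict the choice of [e]. *)
  have := emin q qE qL; rewrite leqNgt => /negP; apply.
  move: q1C q2C; rewrite !inE => /and3P[_ q1l _] /and3P[_ _ q2u].
  apply/proper_card/properP; split.
    by apply/fintype.subsetP => x; rewrite !inE => /andP[-> /=]; lia.
  have [q2|q2] := eqVneq q.2 e.2; last first.
    exists e.2; rewrite !inE e2S ?er ?leqnn//= negb_and -!ltnNge.
    by apply/orP; right; rewrite ltn_neqAle (inj_eq r_inj) q2.
  exists q.1; rewrite !inE q1S ?ltnn//= -q2 (ltnW qr) andbT ltn_neqAle q1l andbT.
  rewrite (inj_eq r_inj); apply: contra qe => /eqP q1.
  by rewrite [q]surjective_pairing [e]surjective_pairing -q1 q2.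
have I_eq := sum_minn (leqW (ltnW eL)).
have X_le : #|X| <= k := Ek e eE.
have E_le : #|E| <= #|E'| + #|X| + #|I|.
  apply: leq_trans (subset_leq_card E_sub) _.
  apply: leq_trans (leq_card_setU _ _) _; rewrite leq_add2r.
  exact: leq_card_setU.
have cS : #|T| + #|S :\: T| = #|S|.
  by have := cardsID T S; rewrite (finset.setIidPr TS).
rewrite -cS.
move: I_le I_eq; set B := bigop _ _ _ => I_le I_eq.
move: E'_le X_le E_le I_le I_eq eL cT kL.
move: #|E| #|E'| #|X| #|I| #|T| #|S :\: T| (span _ _ _) B.
(* Twice the loss is at most [2 k + 2 L (d + 1) - L (L + 1) <= 2 L d + L], where
   [d] is the length of [e]; the budget is [(2 L + 3) (d - 1)], and [d > L]. *)
by move=> a a1 x i t u d B; nia.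
Qed.
End LinearOrder.

Import Order.TTheory GRing.Theory Num.Theory.
Import numFieldNormedType.Exports.
Local Open Scope classical_set_scope.
Local Open Scope ring_scope.

(** * Orientation of triples of points *)

Section Orientation.
Variable R : realType.
Implicit Types a b c d p : plane R.

(** Twice the signed area of the triangle; positive for a left turn. *)
Definition orient a b c : R :=
  (b 0 0 - a 0 0) * (c 0 1 - a 0 1) - (b 0 1 - a 0 1) * (c 0 0 - a 0 0).

Lemma plane_eqP a b : a 0 0 = b 0 0 -> a 0 1 = b 0 1 -> a = b.
Proof.
move=> h0 h1; apply/rowP => -[[|[|//]] i2].
  by rewrite (_ : Ordinal i2 = 0) //; apply: val_inj.
by rewrite (_ : Ordinal i2 = 1) //; apply: val_inj.
Qed.

(** The point of [a c] on the line [b d] divides it in the ratio of the distances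
of [a] and [c] to that line, that is, of the areas [orient a b d] and
[orient b c d]; symmetrically for the point of [b d] on [a c].  Both splittings
have the same denominator, the area of the quadrilateral. *)
Lemma diagonals_meet a b c d :
  0 < orient a b c -> 0 < orient a b d -> 0 < orient a c d ->
  0 < orient b c d -> open_segment a c `&` open_segment b d !=set0.
Proof.
move=> abc abd acd bcd.
have sum_eq : orient a b c + orient a c d = orient a b d + orient b c d.
  by rewrite /orient; ring.
have D0 : orient a b d + orient b c d != 0.
  by apply: lt0r_neq0; exact: addr_gt0.
pose t := orient a b d / (orient a b d + orient b c d).
pose s := orient a b c / (orient a b d + orient b c d).
have frac_itv (x y : R) : 0 < x -> 0 < y -> x / (x + y) \in `]0, 1[.
  move=> x0 y0; rewrite in_itv /= divr_gt0 ?addr_gt0//=.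
  by rewrite ltr_pdivrMr ?addr_gt0// mul1r ltrDl.
exists ((1 - t) *: a + t *: c); split.
  exists t; last by [].
  exact: frac_itv.
exists s; first by rewrite /s -sum_eq; exact: frac_itv.
by apply: plane_eqP; rewrite !mxE /s /t; move: D0; rewrite /orient => D0; field.
Qed.

Lemma convex_set_sum (C : set (plane R)) a b (t : R) :
  convex_set C -> C a -> C b -> 0 <= t -> t <= 1 -> C ((1 - t) *: a + t *: b).
Proof.
move=> Cc Ca Cb t0 t1.
have /= := Cc b a (Itv01 t0 t1); rewrite !inE => /(_ Cb Ca).
by rewrite /conv /= addrC.
Qed.

Lemma convex_set_sum3 (C : set (plane R)) a b c (x y z : R) :
  convex_set C -> C a -> C b -> C c -> 0 <= x -> 0 <= y -> 0 <= z ->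
  x + y + z = 1 -> C (x *: a + y *: b + z *: c).
Proof.
move=> Cc Ca Cb Cc' x0 y0 z0 xyz.
have [z1|z1] := eqVneq z 1.
  have -> : x = 0 by lra.
  have -> : y = 0 by lra.
  by rewrite z1 !scale0r !add0r scale1r.
have w0 : 0 < 1 - z by move/eqP: z1 => z1; lra.
have -> : x *: a + y *: b + z *: c =
    (1 - z) *: ((1 - y / (1 - z)) *: a + (y / (1 - z)) *: b) + z *: c.
  have -> : x = 1 - z - y by lra.
  rewrite scalerDr !scalerA; congr (_ *: _ + _ *: _ + _).
    by field; rewrite lt0r_neq0.
  by field; rewrite lt0r_neq0.
apply: convex_set_sum => //; last by lra.
apply: convex_set_sum => //; first exact: divr_ge0 (ltW w0).
by rewrite ler_pdivrMr// mul1r; lra.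
Qed.

(** The signed areas are, up to the factor [orient o a c], the barycentric
coordinates of [b] in the triangle [o a c]. *)
Lemma convex_set_orient (C : set (plane R)) o a b c :
  convex_set C -> C o -> C a -> C c ->
  0 <= orient o a b -> 0 <= orient o b c -> orient a b c <= 0 ->
  0 < orient o a c -> C b.
Proof.
move=> Cc Co Ca Cc' oab obc abc oac.
have D0 : orient o a c != 0 by rewrite lt0r_neq0.
have -> : b = (- orient a b c / orient o a c) *: o +
    (orient o b c / orient o a c) *: a + (orient o a b / orient o a c) *: c.
  by apply: plane_eqP; rewrite !mxE; move: D0; rewrite /orient => D0; field.
apply: convex_set_sum3 => //.
- by apply: divr_ge0 (ltW oac); rewrite oppr_ge0.
- exact: divr_ge0 (ltW oac).
- exact: divr_ge0 (ltW oac).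
- by move: D0; rewrite /orient => D0; field.
Qed.

Definition lex_lt a b : bool :=
  (a 0 0 < b 0 0) || ((a 0 0 == b 0 0) && (a 0 1 < b 0 1)).

Lemma lex_ltP a b :
  reflect (a 0 0 < b 0 0 \/ a 0 0 = b 0 0 /\ a 0 1 < b 0 1) (lex_lt a b).
Proof.
apply: (iffP orP) => -[h|h]; [by left|right|by left|right].
  by case/andP: h => /eqP.
by case: h => -> ->; rewrite eqxx.
Qed.

(** Lexicographically both points lie beyond [o], so if the three points are aligned
then one of [a] and [b] lies between [o] and the other. *)
Lemma orient_eq0_lex o a b :
  lex_lt o a -> lex_lt o b -> orient o a b = 0 ->
  exists2 t, 0 <= t <= 1 &
    (a = (1 - t) *: o + t *: b) \/ (b = (1 - t) *: o + t *: a).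
Proof.
have scale (u v : plane R) (t : R) : v 0 0 - o 0 0 = t * (u 0 0 - o 0 0) ->
    v 0 1 - o 0 1 = t * (u 0 1 - o 0 1) -> v = (1 - t) *: o + t *: u.
  by move=> h0 h1; apply: plane_eqP; rewrite !mxE; lra.
have frac_le (x y : R) : 0 < x -> x <= y -> 0 <= x / y <= 1.
  move=> x0 xy; have y0 := lt_le_trans x0 xy.
  by rewrite divr_ge0 ?(ltW x0) ?(ltW y0)//= ler_pdivrMr// mul1r.
move=> /lex_ltP la /lex_ltP lb; rewrite /orient => ab.
have [b0|b0] : 0 < b 0 0 - o 0 0 \/ b 0 0 - o 0 0 = 0 by lra.
  have a0 : 0 < a 0 0 - o 0 0.
    case: la => [|[a0 a1]]; first by lra.
    have : 0 < (a 0 1 - o 0 1) * (b 0 0 - o 0 0) by apply: mulr_gt0; lra.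
    by move: ab; rewrite a0 subrr mul0r; lra.
  have [le|le] := leP (a 0 0 - o 0 0) (b 0 0 - o 0 0).
    exists ((a 0 0 - o 0 0) / (b 0 0 - o 0 0)); first exact: frac_le.
    left; apply: scale; first by field; rewrite lt0r_neq0.
    by rewrite mulrAC -[LHS](mulfK (lt0r_neq0 b0)); congr (_ / _); lra.
  exists ((b 0 0 - o 0 0) / (a 0 0 - o 0 0)); first exact: frac_le (ltW le).
  right; apply: scale; first by field; rewrite lt0r_neq0.
  by rewrite mulrAC -[LHS](mulfK (lt0r_neq0 a0)); congr (_ / _); lra.
have b1 : 0 < b 0 1 - o 0 1 by lra.
have a0 : a 0 0 - o 0 0 = 0.
  case: la => [a0|]; last by lra.
  have : 0 < (a 0 0 - o 0 0) * (b 0 1 - o 0 1) by apply: mulr_gt0; lra.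
  by move: ab; rewrite b0 mulr0; lra.
have a1 : 0 < a 0 1 - o 0 1 by lra.
have [le|le] := leP (a 0 1 - o 0 1) (b 0 1 - o 0 1).
  exists ((a 0 1 - o 0 1) / (b 0 1 - o 0 1)); first exact: frac_le.
  left; apply: scale; first by rewrite a0 b0 mulr0.
  by field; rewrite lt0r_neq0.
exists ((b 0 1 - o 0 1) / (a 0 1 - o 0 1)); first exact: frac_le (ltW le).
right; apply: scale; first by rewrite a0 b0 mulr0.
by field; rewrite lt0r_neq0.
Qed.

(** The vectors [p], [q], [w] from [o] to [a], [b], [c] satisfy
[(p x w) q = (q x w) p + (p x q) w].  The right-hand side is a positive
combination of lexicographically positive vectors, so it is lexicographically
positive; since [q] is too, the factor [p x w] must be positive. *)
Lemma orient_lex_trans o a b c : lex_lt o a -> lex_lt o b -> lex_lt o c ->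
  0 < orient o a b -> 0 < orient o b c -> 0 < orient o a c.
Proof.
move=> /lex_ltP la /lex_ltP lb /lex_ltP lc ab bc.
rewrite ltNge; apply/negP => ac.
have e0 : orient o a c * (b 0 0 - o 0 0) =
    orient o b c * (a 0 0 - o 0 0) + orient o a b * (c 0 0 - o 0 0).
  by rewrite /orient; ring.
have e1 : orient o a c * (b 0 1 - o 0 1) =
    orient o b c * (a 0 1 - o 0 1) + orient o a b * (c 0 1 - o 0 1).
  by rewrite /orient; ring.
have n0 : orient o a c * (b 0 0 - o 0 0) <= 0.
  by apply: mulr_le0_ge0 => //; lra.
have pa : 0 <= orient o b c * (a 0 0 - o 0 0).
  by apply: mulr_ge0; [exact: ltW|lra].
have pc : 0 <= orient o a b * (c 0 0 - o 0 0).
  by apply: mulr_ge0; [exact: ltW|lra].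
have a0 : a 0 0 - o 0 0 = 0.
  have /eqP : orient o b c * (a 0 0 - o 0 0) = 0 by lra.
  by rewrite mulf_eq0 (gt_eqF bc) => /eqP.
have c0 : c 0 0 - o 0 0 = 0.
  have /eqP : orient o a b * (c 0 0 - o 0 0) = 0 by lra.
  by rewrite mulf_eq0 (gt_eqF ab) => /eqP.
have pa1 : 0 < orient o b c * (a 0 1 - o 0 1) by apply: mulr_gt0 => //; lra.
have pc1 : 0 < orient o a b * (c 0 1 - o 0 1) by apply: mulr_gt0 => //; lra.
have ac0 : orient o a c = 0 by rewrite /orient a0 c0; ring.
by rewrite ac0 mul0r in e1; lra.
Qed.

End Orientation.

(** * The cyclic order of points in convex position *)

Lemma exists_rank (V : finType) (lt : rel V) :
  irreflexive lt -> transitive lt ->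
  (forall u v, u != v -> lt u v || lt v u) ->
  exists r : V -> nat, injective r /\ forall u v, (r u < r v)%N -> lt u v.
Proof.
move=> irr tr tot; pose r v := #|[set u | lt u v]%SET|.
have mono u v : lt u v -> (r u < r v)%N.
  move=> uv; apply/proper_card/properP; split.
    by apply/fintype.subsetP => x; rewrite !inE => /tr; exact.
  by exists u; rewrite !inE ?uv ?irr.
exists r; split=> [u v ruv|u v ruv].
  apply/eqP/negP => /negP /tot /orP[] /mono; by rewrite ruv ltnn.
have [uv|uv] := eqVneq u v; first by rewrite uv ltnn in ruv.
by case/orP: (tot u v uv) => // /mono /ltn_trans /(_ ruv); rewrite ltnn.
Qed.

Section ConvexPosition.
Variables (R : realType) (V : finType) (pos : V -> plane R).
Hypothesis pos_cvx : convex_position pos.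

Lemma convex_position_notin (v : V) :
  exists C : set (plane R),
    [/\ convex_set C, forall w, w != v -> C (pos w) & ~ C (pos v)].
Proof.
have /existsNP[C /not_implyP[[Cc CV] Cv]] := @pos_cvx v; exists C; split=> // w wv.
by apply: CV; exists w.
Qed.

Lemma pos_inj : injective pos.
Proof.
move=> u v uv; apply/eqP/negP => /negP neq.
by have [C [_ Cw Cv]] := convex_position_notin v; apply: Cv; rewrite -uv; exact: Cw.
Qed.

Lemma exists_lex_min (v0 : V) :
  exists o, forall v, v != o -> lex_lt (pos o) (pos v).
Proof.
pose m := [arg min_(v < v0) pos v 0 0]%O.
have mP v : pos m 0 0 <= pos v 0 0 by rewrite /m; case: arg_minP => // i _; exact.
pose o := [arg min_(v < m | pos v 0 0 == pos m 0 0) pos v 0 1]%O.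
have [/eqP o0 oP] : pos o 0 0 == pos m 0 0 /\
    forall v, pos v 0 0 == pos m 0 0 -> pos o 0 1 <= pos v 0 1.
  by rewrite /o; case: arg_minP => //=.
exists o => v vo; apply/lex_ltP; rewrite o0.
have := mP v; rewrite le_eqVlt => /predU1P[vm|]; [right; split=> //|by left].
rewrite lt_neqAle oP ?vm// andbT; apply: contra vo => /eqP e1.
by apply/eqP/pos_inj/plane_eqP; rewrite // o0.
Qed.

(** Sort by angle around the lexicographically smallest point [z], with [z] first.
For [a < b < c], a right turn at [b] would put it in the triangle [z a c]. *)
Lemma exists_convex_rank :
  exists r : V -> nat, injective r /\
    forall a b c, (r a < r b)%N -> (r b < r c)%N ->
      0 < orient (pos a) (pos b) (pos c).
Proof.
have [V0|/card_gt0P[v0 _]] := posnP #|V|.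
  by exists (fun=> 0%N); split=> a; have := card0_eq V0 a; rewrite inE.
have [z zmin] := exists_lex_min v0.
pose lt u v := (v != z) && ((u == z) || (0 < orient (pos z) (pos u) (pos v))).
have lt_irr : irreflexive lt.
  by move=> v; rewrite /lt /orient mulrC subrr ltxx orbF andNb.
have lt_tr : transitive lt.
  move=> b a c /andP[bz ab] /andP[cz bc]; rewrite /lt cz /=.
  case: eqVneq ab => //= az ab; move: bc; rewrite (negPf bz) /= => bc.
  exact: orient_lex_trans (zmin a az) (zmin b bz) (zmin c cz) ab bc.
have lt_tot u v : u != v -> lt u v || lt v u.
  move=> uv; rewrite /lt; case: (eqVneq u z) uv => [->|uz] uv.
    by rewrite eq_sym uv.
  case: (eqVneq v z) uv => [->|vz] uv //=.
  have anti : orient (pos z) (pos v) (pos u) = - orient (pos z) (pos u) (pos v).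
    by rewrite /orient; ring.
  rewrite anti oppr_gt0; have [//|//|uv0] := ltgtP 0 (orient _ (pos u) (pos v)).
  have [t /andP[t0 t1] [ut|vt]] := orient_eq0_lex (zmin u uz) (zmin v vz) (esym uv0).
    have [C [Cc Cw []]] := convex_position_notin u; rewrite ut.
    by apply: convex_set_sum => //; apply: Cw; rewrite eq_sym.
  have [C [Cc Cw []]] := convex_position_notin v; rewrite vt.
  by apply: convex_set_sum => //; apply: Cw; rewrite // eq_sym.
have [r [r_inj rlt]] := exists_rank lt_irr lt_tr lt_tot.
exists r; split=> // a b c rab rbc.
have /andP[bz ab] := rlt _ _ rab; have /andP[cz bc] := rlt _ _ rbc.
have /andP[_ ac] := rlt _ _ (ltn_trans rab rbc).
rewrite (negPf bz) /= in bc.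
case: (eqVneq a z) ab ac => [-> //|az /= ab ac].
rewrite ltNge; apply/negP => abc.
have neq (x y : V) : (r x != r y)%N -> x != y by apply: contraNneq => ->.
have [C [Cc Cw []]] := convex_position_notin b.
apply: (convex_set_orient Cc _ _ _ (ltW ab) (ltW bc) abc ac); apply: Cw.
- by rewrite eq_sym.
- by apply: neq; rewrite ltn_eqF.
- by apply: neq; rewrite gtn_eqF.
Qed.

End ConvexPosition.

(** * From the drawing to pairs *)

Section Crossings.
Variables (R : realType) (V : finType) (G : convex_geometric_graph R V).
Variable r : V -> nat.
Hypothesis r_inj : injective r.
Hypothesis r_convex : forall a b c, (r a < r b)%N -> (r b < r c)%N ->
  0 < orient (pos G a) (pos G b) (pos G c).

Lemma interiors_meet a b c d : (r a < r b)%N -> (r b < r c)%N -> (r c < r d)%N ->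
  edge_interior G [set a; c]%SET `&` edge_interior G [set b; d]%SET !=set0.
Proof.
move=> ab bc cd.
have ac := ltn_trans ab bc; have bd := ltn_trans bc cd.
have [x [xac xbd]] := diagonals_meet (r_convex ab bc) (r_convex ab bd)
  (r_convex ac cd) (r_convex bc cd).
by exists x; split; [exists a, c | exists b, d].
Qed.

Lemma interleave_crosses p q : interleave r p q ->
  crosses G [set p.1; p.2]%SET [set q.1; q.2]%SET.
Proof.
move=> pq; split.
  apply: contraTneq pq => /setP/(_ p.1); rewrite !inE eqxx /=.
  by move=> /esym/orP[] /eqP p1; rewrite /interleave -p1; lia.
case/orP: pq => /and3P[h1 h2 h3]; first exact: interiors_meet.
by rewrite classical_sets.setIC; exact: interiors_meet.
Qed.

Lemma ordered_pair_inj :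
  {in [pred p : V * V | (r p.1 < r p.2)%N] &,
     injective (fun p : V * V => [set p.1; p.2]%SET)}.
Proof.
move=> [a b] [c d]; rewrite !inE /= => ab cd e.
have : a \in [set c; d]%SET by rewrite -e !inE eqxx.
have : b \in [set c; d]%SET by rewrite -e !inE eqxx orbT.
by rewrite !inE => /orP[] /eqP ? /orP[] /eqP ?; subst=> //; lia.
Qed.

Lemma ordered_pairs_card_edges (k L : nat) : k_plane G k -> (0 < L)%N ->
  (2 * k <= L * L)%N -> (2 * #|edges G| <= (2 * L + 3) * #|V|)%N.
Proof.
move=> Gk L0 kL.
pose P := [set p : V * V | (r p.1 < r p.2)%N && ([set p.1; p.2]%SET \in edges G)]%SET.
have PE : (#|edges G| <= #|P|)%N.
  apply: leq_trans (leq_imset_card (fun p => [set p.1; p.2]%SET) P).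
  apply/subset_leq_card/fintype.subsetP => A AG.
  have /eqP/cards2P[u [v [uv Auv]]] := card_edge AG.
  have := uv; rewrite -(inj_eq r_inj) neq_ltn => /orP[ruv|ruv].
    by apply/imsetP; exists (u, v); rewrite ?inE /= -?Auv ?ruv.
  by apply/imsetP; exists (v, u); rewrite ?inE /= finset.setUC -?Auv ?ruv.
apply: leq_trans (leq_mul (leqnn 2) PE) _; rewrite -cardsT.
apply: (card_interleave_edges_le r_inj L0 kL).
  by move=> p; rewrite inE => /andP[pr _]; rewrite !inE.
move=> p; rewrite inE => /andP[pr pG]; apply: leq_trans (Gk _ pG).
have inj : {in [set q in P | interleave r p q]%SET &,
    injective (fun q : V * V => [set q.1; q.2]%SET)}.
  move=> q q'; rewrite !inE => /andP[/andP[qr _] _] /andP[/andP[qr' _] _].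
  by apply: ordered_pair_inj; rewrite inE.
rewrite -(card_in_imset inj); apply/subset_leq_card/fintype.subsetP => A /imsetP[q].
rewrite !inE => /andP[/andP[_ qG] pq] ->; rewrite qG; apply/asboolP.
exact: interleave_crosses.
Qed.

End Crossings.

Lemma card_edges_k_plane (R : realType) (V : finType)
    (G : convex_geometric_graph R V) (k L : nat) :
  k_plane G k -> (0 < L)%N -> (2 * k <= L * L)%N ->
  (2 * #|edges G| <= (2 * L + 3) * #|V|)%N.
Proof.
have [r [r_inj r_convex]] := exists_convex_rank (pos_convex (c := G)).
exact: ordered_pairs_card_edges r_inj r_convex _ _.
Qed.

(** * The bound *)

Lemma exists_sqrt_ceil (R : realType) (k : nat) :
  exists L : nat, [/\ (0 < L)%N, (2 * k <= L * L)%N &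
    L%:R <= Num.sqrt 2 * Num.sqrt (k%:R : R) + 1].
Proof.
have ex : exists L, (0 < L)%N && (2 * k <= L * L)%N.
  by exists (2 * k).+1; nia.
case: (ex_minnP ex) => -[//|L] /andP[_ kL] Lmin; exists L.+1; split=> //.
rewrite -natr1 lerD2r -sqrtrM// -natrM.
have [->|L0] := posnP L; first exact: sqrtr_ge0.
have -> : L%:R = Num.sqrt (L * L)%:R :> R.
  by rewrite natrM -expr2 sqrtr_sqr ger0_norm.
apply: ler_wsqrtr; rewrite ler_nat leqNgt; apply/negP => kL'.
by have := Lmin L; rewrite L0 (ltnW kL') ltnn => /(_ isT).
Qed.

Lemma cvg_div_sqrt (R : realType) (c : R) :
  c / Num.sqrt n%:R @[n --> \oo] --> (0 : R).
Proof.
apply/cvgrPdist_le => e e0; near=> n.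
have n0 : (0 < n)%N by near: n; exact: nbhs_infty_ge.
have s0 : 0 < Num.sqrt n%:R :> R by rewrite sqrtr_gt0 ltr0n.
rewrite sub0r normrN normrM normfV (gtr0_norm s0) ler_pdivrMr//.
rewrite mulrC -ler_pdivrMr// -[leLHS]ger0_norm ?divr_ge0 ?(ltW e0)//.
rewrite -sqrtr_sqr; apply: ler_wsqrtr; near: n; exact: nbhs_infty_ger.
Unshelve. all: by end_near.
Qed.

Theorem theorem10 (R : realType) :
  exists eps : nat -> R,
    eps n @[n --> \oo] --> (0 : R) /\
    forall k : nat, (1 <= k)%N ->
    forall (n : nat) (V : finType), #|V| = n ->
    forall G : outer_k_planar_graph R k V,
      (#|diagonals G|)%:R <=
        (Num.sqrt 2 + eps k) * Num.sqrt (k%:R : R) * n%:R.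
Proof.
exists (fun k => 5 / 2 / Num.sqrt k%:R); split; first exact: cvg_div_sqrt.
move=> k k1 n V <- G.
have [L [L0 kL Lk]] := exists_sqrt_ceil R k.
have := card_edges_k_plane (@drawing_k_plane _ _ _ G) L0 kL.
have dE : (#|diagonals G| <= #|edges G|)%N.
  by apply/subset_leq_card/fintype.subsetP => A; rewrite inE => /andP[].
move=> /(leq_trans (leq_mul (leqnn 2) dE)); rewrite -(ler_nat R).
rewrite !natrM natrD natrM => bound.
have s0 : Num.sqrt (k%:R : R) != 0 by rewrite sqrtr_eq0 -ltNge ltr0n.
(* [L + 3 / 2 <= sqrt (2 k) + 5 / 2] *)
rewrite [X in X * _](_ : _ = Num.sqrt 2 * Num.sqrt k%:R + 5 / 2); last by field.
have : (L%:R - (Num.sqrt 2 * Num.sqrt k%:R + 1)) * #|V|%:R <= 0 :> R.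
  by apply: mulr_le0_ge0; rewrite ?subr_le0.
lra.
Qed.
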